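(* Let $k$ be a finite field and $r\ge2$. Every irreducible algebraic set over $F_r$ is isomorphic (as an algebraic set) either to a point, or to $\mathrm{Hom}_R(M,\mathrm{Fit}(F_r))\subseteq\mathrm{Fit}(F_r)^n$ for some finitely generated torsion-free module $M$ over $R=k[x_1,\dots,x_r]$ with a finite generating set $m_1,\dots,m_n$. Conversely, every set of either of these forms is an algebraic set over $F_r$.
   Context: $F_r$ is the free metabelian Lie algebra over $k$ with free base $a_1,\dots,a_r$; $\mathrm{Fit}(F_r)=F_r^2$ is an $R$-module via $u\cdot x_i=ua_i$. For a finitely generated $R$-module $M$ with generators $m_1,\dots,m_n$, $\mathrm{Hom}_R(M,\mathrm{Fit}(F_r))$ is identified with the subset $\{(\phi(m_1),\dots,\phi(m_n)):\phi\in\mathrm{Hom}_R(M,\mathrm{Fit}(F_r))\}$ of $F_r^n$. Algebraic geometry over $F_r$: $F_r[X]=F_r\ast F(X)$ with $X=\{x_1,\dots,x_n\}$; for $S\subseteq F_r[X]$, $V(S)=\{p\in F_r^n: f(p)=0\ \forall f\in S\}$ is an algebraic set. The Zariski topology on $F_r^n$ has algebraic sets as a sub-basis of closed sets; a closed set is irreducible if it is not the union of two closed proper subsets. A morphism $Y\to Z$ between algebraic sets $Y\subseteq F_r^n$, $Z\subseteq F_r^m$ is a map of the form $p\mapsto(f_1(p),\dots,f_m(p))$ with $f_i\in F_r[x_1,\dots,x_n]$; $Y$ and $Z$ are isomorphic if there are morphisms $Y\to Z$, $Z\to Y$ that are mutually inverse. *)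

(* Defs.v *)
From HB Require Import structures.
From mathcomp Require Import all_boot all_order all_algebra all_field.
From mathcomp Require Import mpoly.
Set Implicit Arguments. Unset Strict Implicit. Unset Printing Implicit Defensive.
Import Order.TTheory GRing.Theory.
Local Open Scope ring_scope.

Section LieDefs.
Variable k : fieldType.

Definition lie_alg (L : lmodType k) (br : L -> L -> L) : Prop :=
  (forall x y z, br (x + y) z = br x z + br y z) /\
  (forall (c : k) x y, br (c *: x) y = c *: br x y) /\
  (forall x y z, br x (y + z) = br x y + br x z) /\
  (forall (c : k) x y, br x (c *: y) = c *: br x y) /\
  (forall x, br x x = 0) /\
  (forall x y z, br x (br y z) + br y (br z x) + br z (br x y) = 0).

Definition metabelian (L : lmodType k) (br : L -> L -> L) : Prop :=
  forall x y z w, br (br x y) (br z w) = 0.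

Definition lie_hom (L M : lmodType k) (brL : L -> L -> L) (brM : M -> M -> M)
  (h : L -> M) : Prop :=
  [/\ (forall x y, h (x + y) = h x + h y),
      (forall (c : k) x, h (c *: x) = c *: h x) &
      (forall x y, h (brL x y) = brM (h x) (h y))].

Definition free_metabelian_on (r : nat) (L : lmodType k) (br : L -> L -> L)
  (a : 'I_r -> L) : Prop :=
  [/\ lie_alg br, metabelian br &
      forall (M : lmodType k) (brM : M -> M -> M),
        lie_alg brM -> metabelian brM -> forall g : 'I_r -> M,
        exists h : L -> M,
          [/\ lie_hom br brM h, (forall i, h (a i) = g i) &
              forall h' : L -> M, lie_hom br brM h' ->
                (forall i, h' (a i) = g i) -> forall x, h' x = h x]].

(* the derived algebra L^2 = span of all brackets (= Fit(F_r)) *)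
Definition derived (L : lmodType k) (br : L -> L -> L) (x : L) : Prop :=
  exists s : seq (L * L), x = \sum_(p <- s) br p.1 p.2.

(* R-module action of R = k[x_1..x_r] on L^2 : u . x_i = [u, a_i] *)
Definition ad_mono (r : nat) (L : lmodType k) (br : L -> L -> L)
  (a : 'I_r -> L) (m : 'X_{1..r}) (u : L) : L :=
  foldr (fun i v => iter (m i) (fun w => br w (a i)) v) u (enum 'I_r).

Definition ract (r : nat) (L : lmodType k) (br : L -> L -> L)
  (a : 'I_r -> L) (P : {mpoly k[r]}) (u : L) : L :=
  \sum_(m <- msupp P) P@_m *: ad_mono br a m u.

Definition hom_set (r : nat) (L : lmodType k) (br : L -> L -> L)
  (a : 'I_r -> L) (M : lmodType {mpoly k[r]}) (n : nat) (m : 'I_n -> M)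
  (p : 'I_n -> L) : Prop :=
  exists phi : M -> L,
    [/\ (forall x, derived br (phi x)),
        (forall x y, phi (x + y) = phi x + phi y),
        (forall (c : {mpoly k[r]}) x, phi (c *: x) = ract br a c (phi x)) &
        (forall i, p i = phi (m i))].

Definition generates (R : comRingType) (M : lmodType R) (n : nat)
  (m : 'I_n -> M) : Prop :=
  forall x, exists c : 'I_n -> R, x = \sum_i c i *: m i.

Definition torsion_free (R : comRingType) (M : lmodType R) : Prop :=
  forall (c : R) (x : M), c *: x = 0 -> c = 0 \/ x = 0.

(* Terms of F_r[X] = F_r * F(X), X = {x_1..x_n}: every element is built from
   constants of F_r and variables by +, k-scaling and bracket. *)
Inductive term (L : lmodType k) (n : nat) : Type :=
| tConst of L
| tVar of 'I_n
| tAdd of term L n & term L n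
| tScale of k & term L n
| tBr of term L n & term L n.

Fixpoint teval (L : lmodType k) (br : L -> L -> L) (n : nat) (p : 'I_n -> L)
  (t : term L n) : L :=
  match t with
  | tConst c => c
  | tVar i => p i
  | tAdd t1 t2 => teval br p t1 + teval br p t2
  | tScale c t1 => c *: teval br p t1
  | tBr t1 t2 => br (teval br p t1) (teval br p t2)
  end.

Definition Vset (L : lmodType k) (br : L -> L -> L) (n : nat)
  (S : term L n -> Prop) (p : 'I_n -> L) : Prop :=
  forall f, S f -> teval br p f = 0.

Definition algebraic (L : lmodType k) (br : L -> L -> L) (n : nat)
  (Y : ('I_n -> L) -> Prop) : Prop :=
  exists S : term L n -> Prop, forall p, Y p <-> Vset br S p.

Definition zclosed (L : lmodType k) (br : L -> L -> L) (n : nat)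
  (Y : ('I_n -> L) -> Prop) : Prop :=
  exists (I : Type) (N : I -> nat) (F : I -> nat -> term L n -> Prop),
    forall p, Y p <-> (forall i, exists2 j, (j < N i)%N & Vset br (F i j) p).

Definition irreducible (L : lmodType k) (br : L -> L -> L) (n : nat)
  (Y : ('I_n -> L) -> Prop) : Prop :=
  [/\ zclosed br Y, exists p, Y p &
      ~ exists Y1 Y2 : ('I_n -> L) -> Prop,
        zclosed br Y1 /\ zclosed br Y2 /\
        (forall p, Y1 p -> Y p) /\ (exists p, Y p /\ ~ Y1 p) /\
        (forall p, Y2 p -> Y p) /\ (exists p, Y p /\ ~ Y2 p) /\
        (forall p, Y p <-> Y1 p \/ Y2 p)].

Definition morphism (L : lmodType k) (br : L -> L -> L) (n m : nat)
  (Y : ('I_n -> L) -> Prop) (Z : ('I_m -> L) -> Prop)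
  (f : 'I_m -> term L n) : Prop :=
  forall p, Y p -> Z (fun j => teval br p (f j)).

Definition isomorphic (L : lmodType k) (br : L -> L -> L) (n m : nat)
  (Y : ('I_n -> L) -> Prop) (Z : ('I_m -> L) -> Prop) : Prop :=
  exists (f : 'I_m -> term L n) (g : 'I_n -> term L m),
    [/\ morphism br Y Z f, morphism br Z Y g,
        (forall p, Y p ->
           (fun i => teval br (fun j => teval br p (f j)) (g i)) = p) &
        (forall q, Z q ->
           (fun j => teval br (fun i => teval br q (g i)) (f j)) = q)].

End LieDefs.

(* Main.v *)
(** The Lie algebra [F] maps to [R ⋉ R^r] by [a_l |-> (x_l, t_l)] (the Magnus embedding); its
    restriction to [Fit F] is [R]-linear and, by a normal form for elements of [Fit F],
    injective, so [Fit F] is torsion-free over [R].  As [k] is finite, [F^n] is a finite union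
    of cosets of [Fit^n], each of them algebraic, so an irreducible algebraic set lies in a
    single coset; translating by one of its points gives a set [Y0] in [Fit^n] cut out by
    homogeneous [R]-linear equations.  If [K] is the submodule of all [R]-linear relations
    valid on [Y0], then [R^n / K] is torsion-free because [Fit F] is, and
    [Y0 = Hom(R^n / K, Fit F)]; a point is the case of the zero module. *)
Require Import Defs.
From HB Require Import structures.
From mathcomp Require Import all_boot all_order all_algebra all_field.
From mathcomp Require Import mpoly ring_quotient ring zify.
From Stdlib Require Import FunctionalExtensionality ClassicalEpsilon.
Set Implicit Arguments. Unset Strict Implicit. Unset Printing Implicit Defensive.
Import GRing.Theory.
Local Open Scope ring_scope.

(** * Submodules and quotient modules given by a propositional predicate *)

Section Submodule.
Variables (R : nzRingType) (V : lmodType R) (P : V -> Prop).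
Hypotheses (P0 : P 0) (PL : forall (c : R) x y, P x -> P y -> P (c *: x + y)).

(** Submodule and quotient structures are built on Boolean predicates, so membership is decided
    classically. *)
Definition classical_pred : {pred V} :=
  fun x => if excluded_middle_informative (P x) then true else false.

Lemma classical_predP x : reflect (P x) (x \in classical_pred).
Proof.
rewrite unfold_in /classical_pred.
by case: excluded_middle_informative => h; constructor.
Qed.

Lemma classical_pred_submod : submod_closed classical_pred.
Proof.
split; first exact/classical_predP.
by move=> c x y /classical_predP Px /classical_predP Py; apply/classical_predP/PL.
Qed.

Lemma submodule_exists : exists (M : lmodType R) (i : M -> V),
  [/\ linear i, injective i, forall x, P (i x) & forall y, P y -> exists x, i x = y].
Proof.
pose T := {x : V | x \in classical_pred}.
pose Sm := GRing.SubChoice_isSubLmodule.Build R V classical_pred T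
  (GRing.submod_closed_semi classical_pred_submod).
pose M : lmodType R := HB.pack T Sm.
pose L : subLmodType classical_pred := HB.pack T Sm.
exists M, val; split.
- move=> c x y; exact: (linearP (val : L -> V)).
- exact: val_inj.
- by move=> x; apply/classical_predP/(valP x).
- by move=> y /classical_predP hy; exists (Sub y hy); rewrite SubK.
Qed.

Lemma quotient_module_exists : exists (M : lmodType R) (pi : V -> M),
  [/\ linear pi, forall x, pi x = 0 <-> P x & forall y, exists x, pi x = y].
Proof.
pose I : zmodClosed V := HB.pack classical_pred
  (GRing.isZmodClosed.Build V classical_pred
    (GRing.submod_closedB classical_pred_submod)).
pose Q := Quotient.quot I.
Local Open Scope quotient_scope.
(* Scalars act on a chosen representative; [scE] shows that the class does not depend on it, as [P]
   is stable under scalars. *)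
pose sc (c : R) (x : Q) : Q := \pi_Q (c *: repr x).
have piE x y : (\pi_Q x = \pi_Q y) <-> P (x - y).
  split=> [/eqP|/classical_predP h]; first by rewrite -Quotient.idealrBE => /classical_predP.
  by apply/eqP; rewrite -Quotient.idealrBE.
have PZ c x : P x -> P (c *: x) by move=> Px; rewrite -[_ *: _]addr0; apply: PL.
have sur (x : Q) : exists y, x = \pi_Q y by exists (repr x); rewrite reprK.
have scE c x : sc c (\pi_Q x) = \pi_Q (c *: x).
  by apply/(proj2 (piE _ _)); rewrite -scalerBr; apply/PZ/piE; rewrite reprK.
have scA c d x : sc c (sc d x) = sc (c * d) x.
  by have [y ->] := sur x; rewrite !scE scalerA.
have sc1 : left_id 1 sc by move=> x; have [y ->] := sur x; rewrite scE scale1r.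
have scDr : right_distributive sc +%R.
  move=> c x y; have [[x' ->] [y' ->]] := (sur x, sur y).
  by rewrite -(raddfD \pi_Q) !scE scalerDr raddfD.
have scDl x : {morph sc^~ x : c d / c + d}.
  by move=> c d; have [y ->] := sur x; rewrite !scE scalerDl raddfD.
pose M : lmodType R := HB.pack Q (GRing.Zmodule_isLmodule.Build R Q scA sc1 scDr scDl).
exists M, \pi_Q; split.
- move=> c x y; rewrite (raddfD \pi_Q); congr (_ + _); exact/esym/scE.
- by move=> x; rewrite -(raddf0 \pi_Q) piE subr0.
- by move=> y; have [x ->] := sur y; exists x.
Qed.

End Submodule.

(** * Bracket identities in a metabelian Lie algebra *)

Section MetabelianLie.
Variables (k : fieldType) (r : nat) (L : lmodType k) (br : L -> L -> L).
Variable a : 'I_r -> L.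
Hypotheses (lieL : lie_alg br) (metL : metabelian br).

Lemma brDl x y z : br (x + y) z = br x z + br y z.
Proof. by case: lieL. Qed.
Lemma brZl c x y : br (c *: x) y = c *: br x y.
Proof. by case: lieL => _ []. Qed.
Lemma brDr x y z : br x (y + z) = br x y + br x z.
Proof. by case: lieL => _ [_ []]. Qed.
Lemma brZr c x y : br x (c *: y) = c *: br x y.
Proof. by case: lieL => _ [_ [_ []]]. Qed.
Lemma brxx x : br x x = 0.
Proof. by case: lieL => _ [_ [_ [_ []]]]. Qed.
Lemma br_jacobi x y z : br x (br y z) + br y (br z x) + br z (br x y) = 0.
Proof. by case: lieL => _ [_ [_ [_ []]]]. Qed.
Lemma br0l x : br 0 x = 0.
Proof. by rewrite -[0 in LHS](scale0r 0) brZl scale0r. Qed.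
Lemma br0r x : br x 0 = 0.
Proof. by rewrite -[0 in LHS](scale0r 0) brZr scale0r. Qed.
Lemma brNl x y : br (- x) y = - br x y.
Proof. by rewrite -scaleN1r brZl scaleN1r. Qed.
Lemma br_anti x y : br x y = - br y x.
Proof.
apply/eqP; rewrite -addr_eq0; apply/eqP.
by have := brxx (x + y); rewrite brDl !brDr !brxx add0r addr0.
Qed.
Lemma br_suml I (s : seq I) (F : I -> L) y :
  br (\sum_(i <- s) F i) y = \sum_(i <- s) br (F i) y.
Proof. by apply: (big_morph (br^~ y)) => [? ?|]; rewrite ?brDl ?br0l. Qed.
Lemma br_sumr I (s : seq I) (F : I -> L) x :
  br x (\sum_(i <- s) F i) = \sum_(i <- s) br x (F i).
Proof. by apply: (big_morph (br x)) => [? ?|]; rewrite ?brDr ?br0r. Qed.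

Lemma derived_br x y : derived br (br x y).
Proof. by exists [:: (x, y)]; rewrite big_seq1. Qed.
Lemma derived0 : derived br 0.
Proof. by exists [::]; rewrite big_nil. Qed.
Lemma derivedD x y : derived br x -> derived br y -> derived br (x + y).
Proof. by move=> [s ->] [t ->]; exists (s ++ t); rewrite big_cat. Qed.
Lemma derivedZ c x : derived br x -> derived br (c *: x).
Proof.
move=> [s ->]; exists [seq (c *: p.1, p.2) | p <- s].
by rewrite big_map scaler_sumr; apply: eq_bigr => p _; rewrite brZl.
Qed.
Lemma derivedN x : derived br x -> derived br (- x).
Proof. by rewrite -scaleN1r; apply: derivedZ. Qed.
Lemma derived_sum I (s : seq I) (F : I -> L) :
  (forall i, derived br (F i)) -> derived br (\sum_(i <- s) F i).
Proof.
by move=> dF; elim/big_rec: _ => [|i x _ dx]; [exact: derived0|exact: derivedD].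
Qed.

Lemma br_derived u v : derived br u -> derived br v -> br u v = 0.
Proof.
move=> [s ->] [t ->]; rewrite br_suml big1 // => p _.
by rewrite br_sumr big1 // => q _; apply: metL.
Qed.

(** In the Jacobi identity the term [br u (br x y)] vanishes by metabelianity. Hence the operators
    of bracketing commute on Fit, which is what makes Fit a module over a commutative polynomial
    ring. *)
Lemma br_derivedAC u x y : derived br u -> br (br u x) y = br (br u y) x.
Proof.
move=> du; have := br_jacobi u x y.
rewrite (br_derived du (derived_br _ _)) add0r.
rewrite (br_anti x) (br_anti y u) brNl opprK (br_anti y).
by move/eqP; rewrite subr_eq0 => /eqP ->.
Qed.

(** * Iterated brackets with the base, indexed by monomials *)

Let ad i w := br w (a i).
(** This is [ad_mono] with the enumeration of the indices replaced by any list, so that induction on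
    the list is possible. *)
Let adl (m : 'X_{1..r}) s u := foldr (fun i v => iter (m i) (ad i) v) u s.

Lemma ad_ind (P : L -> Prop) m s u :
  (forall i v, P v -> P (br v (a i))) -> P u -> P (adl m s u).
Proof.
move=> Pad Pu; elim: s => //= i s ih.
by elim: (m i) => //= n; apply: Pad.
Qed.

Lemma ad_monoDr m u v :
  ad_mono br a m (u + v) = ad_mono br a m u + ad_mono br a m v.
Proof.
rewrite /ad_mono; elim: (enum _) => //= i s ->.
by elim: (m i) => //= n ->; rewrite brDl.
Qed.

Lemma ad_monoZr m c u : ad_mono br a m (c *: u) = c *: ad_mono br a m u.
Proof.
rewrite /ad_mono; elim: (enum _) => //= i s ->.
by elim: (m i) => //= n ->; rewrite brZl.
Qed.

Lemma derived_ad_mono m u : derived br u -> derived br (ad_mono br a m u).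
Proof. by move=> du; apply: ad_ind => // i v _; apply: derived_br. Qed.

Lemma ad_mono0 u : ad_mono br a 0%MM u = u.
Proof. by rewrite /ad_mono; elim: (enum _) => //= i s ->; rewrite mnm0E. Qed.

Lemma ad_monoU i u : ad_mono br a U_(i)%MM u = br u (a i).
Proof.
have adl_U s : uniq s -> adl U_(i)%MM s u = if i \in s then br u (a i) else u.
  elim: s => //= j s ih /andP[js us]; rewrite ih // mnm1E in_cons.
  by case: eqVneq js => [->|] //= /negPf->.
by rewrite /ad_mono -/(adl _ _ _) adl_U ?enum_uniq // mem_enum.
Qed.

Lemma ad_mono_br m u i :
  derived br u -> ad_mono br a m (br u (a i)) = br (ad_mono br a m u) (a i).
Proof.
rewrite /ad_mono => du; elim: (enum _) => //= j s ->.
have: derived br (adl m s u) by apply: ad_ind => // *; apply: derived_br.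
rewrite -/(adl m s u); move: (adl m s u) => v dv.
elim: (m j) => //= n ->; rewrite br_derivedAC //.
by case: n => //= n; apply: derived_br.
Qed.

Lemma ad_monoD m m' u :
  derived br u -> ad_mono br a (m + m')%MM u = ad_mono br a m (ad_mono br a m' u).
Proof.
move=> du; rewrite /ad_mono -!/(adl _ _ _).
have dA s n v : derived br v -> derived br (adl n s v).
  by move=> dv; apply: ad_ind => // *; apply: derived_br.
have dI n i v : derived br v -> derived br (iter n (ad i) v).
  by move=> dv; elim: n => //= *; apply: derived_br.
have iterC i j n p v : derived br v ->
    iter n (ad i) (iter p (ad j) v) = iter p (ad j) (iter n (ad i) v).
  move=> dv; elim: n => //= n ->.
  elim: p => //= p ih; rewrite -ih {1}/ad br_derivedAC //.
  exact/dI/dI.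
have adlC s n i p v : derived br v ->
    adl n s (iter p (ad i) v) = iter p (ad i) (adl n s v).
  by move=> dv; elim: s => //= j s ->; rewrite iterC //; apply: dA.
elim: (enum _) => //= i s ->.
by rewrite mnmDE iterD adlC //; apply: dA.
Qed.

(** * The action of the polynomial ring on Fit *)

Local Notation ract := (ract br a).

(** Coefficients outside the support are zero; a larger index list can thus be shared by two
    polynomials, as additivity requires. *)
Lemma ract_supp (s : seq 'X_{1..r}) P u : uniq s -> {subset msupp P <= s} ->
  ract P u = \sum_(m <- s) P@_m *: ad_mono br a m u.
Proof.
move=> us sub; rewrite [RHS](bigID (mem (msupp P))) /= addrC big1 => [|m].
  rewrite add0r -big_filter; apply: perm_big; apply: uniq_perm.
  - exact: msupp_uniq.
  - exact: filter_uniq.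
  - move=> m; rewrite mem_filter; apply/idP/andP => [mP|[]//].
    by split; last exact: sub.
by move=> /memN_msupp_eq0 ->; rewrite scale0r.
Qed.

Lemma ractDl P Q u : ract (P + Q) u = ract P u + ract Q u.
Proof.
pose s := undup (msupp P ++ msupp Q).
have us : uniq s by apply: undup_uniq.
rewrite !(@ract_supp s) // => [|m|m|m]; rewrite ?mem_undup ?mem_cat.
- by rewrite -big_split; apply: eq_bigr => m _; rewrite mcoeffD scalerDl.
- by move->; rewrite orbT.
- by move->.
- by move/msuppD_le; rewrite mem_cat.
Qed.

Lemma ractZl c P u : ract (c *: P) u = c *: ract P u.
Proof.
rewrite (@ract_supp (msupp P)) // => [|m /msuppZ_le //].
by rewrite scaler_sumr; apply: eq_bigr => m _; rewrite mcoeffZ scalerA.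
Qed.

Lemma ract0l u : ract 0 u = 0.
Proof. by have := ractZl 0 0 u; rewrite !scale0r. Qed.
Lemma ractNl P u : ract (- P) u = - ract P u.
Proof. by have := ractZl (-1) P u; rewrite !scaleN1r. Qed.
Lemma ract_suml I (s : seq I) (F : I -> {mpoly k[r]}) u :
  ract (\sum_(i <- s) F i) u = \sum_(i <- s) ract (F i) u.
Proof. by apply: (big_morph (ract^~ u)) => [? ?|]; rewrite ?ractDl ?ract0l. Qed.

Lemma ractDr P u v : ract P (u + v) = ract P u + ract P v.
Proof. by rewrite -big_split; apply: eq_bigr => m _; rewrite ad_monoDr scalerDr. Qed.
Lemma ractZr P c u : ract P (c *: u) = c *: ract P u.
Proof.
rewrite scaler_sumr; apply: eq_bigr => m _.
by rewrite ad_monoZr !scalerA mulrC.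
Qed.
Lemma ract0r P : ract P 0 = 0.
Proof. by rewrite -(scale0r (0 : L)) ractZr !scale0r. Qed.
Lemma ract_sumr I (s : seq I) (F : I -> L) P :
  ract P (\sum_(i <- s) F i) = \sum_(i <- s) ract P (F i).
Proof. by apply: (big_morph (ract P)) => [? ?|]; rewrite ?ractDr ?ract0r. Qed.

Lemma derived_ract P u : derived br u -> derived br (ract P u).
Proof.
by move=> du; apply: derived_sum => m; apply/derivedZ/derived_ad_mono.
Qed.

Lemma ractX m u : ract 'X_[m] u = ad_mono br a m u.
Proof. by rewrite /Defs.ract msuppX big_seq1 mcoeffX eqxx scale1r. Qed.
Lemma ractXU i u : ract 'X_i u = br u (a i).
Proof. by rewrite ractX ad_monoU. Qed.
Lemma ract1 u : ract 1 u = u.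
Proof. by rewrite -mpolyX0 ractX ad_mono0. Qed.

Lemma ractM P Q u : derived br u -> ract (P * Q) u = ract P (ract Q u).
Proof.
move=> du; rewrite (mpolyE P) (mpolyE Q) mulr_suml !ract_suml.
apply: eq_bigr => m _; rewrite mulr_sumr ract_suml ract_sumr.
apply: eq_bigr => m' _; rewrite -scalerAl -scalerAr !ractZl ractZr.
by rewrite -mpolyXD !ractX ad_monoD.
Qed.

Lemma br_span (al : 'I_r -> k) u w : derived br u -> derived br w ->
  br u (\sum_i al i *: a i + w) = ract (\sum_i al i *: 'X_i) u.
Proof.
move=> du dw; rewrite brDr (br_derived du dw) addr0 br_sumr ract_suml.
by apply: eq_bigr => i _; rewrite brZr ractZl ractXU.
Qed.

(** * Generation by the base and normal forms in Fit *)

Hypothesis freeL : free_metabelian_on br a.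

(** The subset is itself a metabelian Lie algebra [M]. The map to [M] given by freeness, followed by
    the inclusion, fixes the base and so is the identity by uniqueness. *)
Lemma subalgebra_full (P : L -> Prop) :
  P 0 -> (forall (c : k) x y, P x -> P y -> P (c *: x + y)) ->
  (forall x y, P x -> P y -> P (br x y)) -> (forall i, P (a i)) -> forall x, P x.
Proof.
move=> P0 PL Pbr Pa x.
have [M [i [i_lin i_inj Pi iP]]] := submodule_exists P0 PL.
have iD u v : i (u + v) = i u + i v by have := i_lin 1 u v; rewrite !scale1r.
have i0 : i 0 = 0 by apply: (@addrI _ (i 0)); rewrite -iD !addr0.
have iZ c u : i (c *: u) = c *: i u by have := i_lin c u 0; rewrite i0 !addr0.
pose lift y (Py : P y) := proj1_sig (constructive_indefinite_description _ (iP y Py)).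
have liftK y (Py : P y) : i (lift y Py) = y.
  exact: proj2_sig (constructive_indefinite_description _ (iP y Py)).
pose brM u v := lift _ (Pbr _ _ (Pi u) (Pi v)).
have ibr u v : i (brM u v) = br (i u) (i v) by apply: liftK.
have lieM : lie_alg brM.
  do !split=> *; apply: i_inj; rewrite ?(ibr, iD, iZ, i0).
  - exact: brDl.
  - exact: brZl.
  - exact: brDr.
  - exact: brZr.
  - exact: brxx.
  - exact: br_jacobi.
have metM : metabelian brM by move=> *; apply: i_inj; rewrite i0 !ibr metL.
have [_ _ univ] := freeL.
have [f [[fD fZ fbr] fa _]] := univ M brM lieM metM (fun j => lift _ (Pa j)).
have [g [_ _ g_uniq]] := univ L br lieL metL a.
have gid : g x = x by rewrite -(g_uniq id).
have gif : i (f x) = g x.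
  apply: (g_uniq (fun y => i (f y))); last by move=> j; rewrite fa liftK.
  by split=> *; rewrite ?(fD, fZ, fbr) ?(iD, iZ, ibr).
by rewrite -gid -gif; apply: Pi.
Qed.

(** The monomials allowed are [a_i, a_j] x^m with j < i and x^m free of the variables before x_j:
    the usual basis of the derived algebra. *)
Definition normal_coef (c : 'I_r -> 'I_r -> {mpoly k[r]}) :=
  forall i j m, (c i j)@_m != 0 -> (j < i)%N /\ forall l : 'I_r, (l < j)%N -> m l = 0%N.

Definition normal_sum (c : 'I_r -> 'I_r -> {mpoly k[r]}) : L :=
  \sum_i \sum_j ract (c i j) (br (a i) (a j)).

Definition normal u := exists2 c, normal_coef c & u = normal_sum c.

Lemma normal0 : normal 0.
Proof.
exists (fun _ _ => 0); first by move=> i j m; rewrite mcoeff0 eqxx.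
by rewrite /normal_sum big1 // => i _; rewrite big1 // => j _; rewrite ract0l.
Qed.

Lemma normalZD c u v : normal u -> normal v -> normal (c *: u + v).
Proof.
move=> [d dn ->] [e en ->]; exists (fun i j => c *: d i j + e i j).
  move=> i j m; rewrite mcoeffD mcoeffZ.
  have [->|/dn //] := eqVneq ((d i j)@_m) 0.
  by rewrite mulr0 add0r => /en.
rewrite /normal_sum scaler_sumr -big_split; apply: eq_bigr => i _ /=.
rewrite scaler_sumr -big_split; apply: eq_bigr => j _ /=.
by rewrite ractDl ractZl.
Qed.

Lemma normalD u v : normal u -> normal v -> normal (u + v).
Proof. by move=> nu nv; have := normalZD 1 nu nv; rewrite scale1r. Qed.
Lemma normalZ c u : normal u -> normal (c *: u).
Proof. by move=> nu; rewrite -[_ *: _]addr0; apply: normalZD => //; apply: normal0. Qed.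
Lemma normalN u : normal u -> normal (- u).
Proof. by rewrite -scaleN1r; apply: normalZ. Qed.
Lemma normal_sumr I (s : seq I) (Q : pred I) (F : I -> L) :
  (forall i, Q i -> normal (F i)) -> normal (\sum_(i <- s | Q i) F i).
Proof.
by move=> nF; elim/big_rec: _ => [|i x /nF ? ?]; [exact: normal0|exact: normalD].
Qed.

Lemma normal_monomial (i j : 'I_r) (m : 'X_{1..r}) :
  (j < i)%N -> (forall l : 'I_r, (l < j)%N -> m l = 0%N) ->
  normal (ract 'X_[m] (br (a i) (a j))).
Proof.
move=> ji mj; exists (fun i' j' => if (i' == i) && (j' == j) then 'X_[m] else 0).
  move=> i' j' m'; case: ifP => [/andP[/eqP-> /eqP->]|_]; last by rewrite mcoeff0 eqxx.
  by rewrite mcoeffX; case: (eqVneq m m') => [<- _|_ /eqP].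
rewrite /normal_sum (bigD1 i) //= (bigD1 j) //= !eqxx /= big1 => [|j' /negPf->].
  rewrite big1 ?addr0 // => i' /negPf->; rewrite big1 // => j' _; exact: ract0l.
exact: ract0l.
Qed.

(* Jacobi in the form [e_ij x_l = e_il x_j - e_jl x_i] lowers the second index. *)
Lemma normal_monomial_X (i j l : 'I_r) (m : 'X_{1..r}) :
  (j < i)%N -> (forall l : 'I_r, (l < j)%N -> m l = 0%N) ->
  normal (ract 'X_[m + U_(l)] (br (a i) (a j))).
Proof.
move=> ji mj; have [jl|lj] := leqP j l.
  apply: normal_monomial => // l' l'j; rewrite mnmDE mj // mnm1E.
  by case: eqVneq => // ll'; move: l'j; rewrite -ll' ltnNge jl.
have dbr := derived_br.
have jac : br (br (a i) (a j)) (a l)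
    = br (br (a i) (a l)) (a j) - br (br (a j) (a l)) (a i).
  have := br_jacobi (a i) (a j) (a l).
  rewrite (br_anti (a i) (br _ _)) (br_anti (a j) (br _ _)) (br_anti (a l) (br _ _)).
  rewrite (br_anti (a l) (a i)) brNl opprK => /eqP.
  by rewrite subr_eq0 addrC => /eqP <-.
rewrite ractX ad_monoD // ad_monoU jac ad_monoDr -[- br _ _]scaleN1r ad_monoZr scaleN1r.
rewrite -(ad_monoU j (br _ _)) -(ad_monoU i (br _ _)) -!ad_monoD // -!ractX.
have li := ltn_trans lj ji.
apply: normalD; last apply: normalN; apply: normal_monomial => // l' l'l;
  rewrite mnmDE mnm1E mj ?(ltn_trans l'l) //.
  by case: (eqVneq j l') => // jl'; move: l'l; rewrite -jl' ltnNge ltnW.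
by case: (eqVneq i l') => // il'; move: l'l; rewrite -il' ltnNge ltnW.
Qed.

Lemma normal_derived u : normal u -> derived br u.
Proof.
move=> [c _ ->]; apply: derived_sum => i; apply: derived_sum => j.
exact/derived_ract/derived_br.
Qed.

(** The bracket with [a l] multiplies each monomial of each coefficient by x_l, and
    [normal_monomial_X] rewrites the result. *)
Lemma normal_br u l : normal u -> normal (br u (a l)).
Proof.
move=> [c cn ->]; rewrite br_suml; apply: normal_sumr => i _.
rewrite br_suml; apply: normal_sumr => j _.
rewrite br_suml big_seq; apply: normal_sumr => m; rewrite mcoeff_msupp => /cn[ji mj].
rewrite brZl -ad_mono_br; last exact: derived_br.
rewrite -(ad_monoU l (br _ _)) -ad_monoD -?ractX; last exact: derived_br.
exact/normalZ/normal_monomial_X.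
Qed.

Lemma normal_gen i j : normal (br (a i) (a j)).
Proof.
have nlt (i' j' : 'I_r) : (j' < i')%N -> normal (br (a i') (a j')).
  by move=> ji; rewrite -[br _ _]ract1 -mpolyX0; apply: normal_monomial => // l _; rewrite mnm0E.
case: (ltngtP j i) => [/nlt //|ij|/val_inj->]; last by rewrite brxx; apply: normal0.
by rewrite br_anti; apply/normalN/nlt.
Qed.

Definition spanned x := exists (al : 'I_r -> k) w, normal w /\ x = \sum_i al i *: a i + w.

(** After expansion, linear parts give brackets of base elements, mixed terms fall under
    [normal_br], and the bracket of the two Fit parts is zero. *)
Lemma spanned_br x y : spanned x -> spanned y -> normal (br x y).
Proof.
move=> [al [u [nu ->]]] [be [v [nv ->]]].
have nA w (ga : 'I_r -> k) : normal w -> normal (br w (\sum_i ga i *: a i)).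
  move=> nw; rewrite br_sumr; apply: normal_sumr => i _.
  by rewrite brZr; apply/normalZ/normal_br.
rewrite brDl !brDr (br_derived (normal_derived nu) (normal_derived nv)) addr0.
rewrite (br_anti (\sum_i _) v).
apply: normalD (nA _ _ nu); apply: normalD (normalN (nA _ _ nv)).
rewrite br_suml; apply: normal_sumr => i _; rewrite brZl; apply: normalZ.
rewrite br_sumr; apply: normal_sumr => j _; rewrite brZr; apply: normalZ.
exact: normal_gen.
Qed.

Lemma spannedP x : spanned x.
Proof.
apply: (subalgebra_full (P := spanned)).
- exists (fun=> 0), 0; split; first exact: normal0.
  by rewrite addr0 big1 // => i _; rewrite scale0r.
- move=> c {}x y [al [u [nu ->]]] [be [v [nv ->]]].
  exists (fun i => c * al i + be i), (c *: u + v); split; first exact: normalZD.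
  rewrite scalerDr addrACA scaler_sumr -big_split /=; congr (_ + _).
  by apply: eq_bigr => i _; rewrite scalerDl scalerA.
- move=> {}x y sx sy; exists (fun=> 0), (br x y); split; first exact: spanned_br.
  by rewrite big1 ?add0r // => i _; rewrite scale0r.
- move=> i; exists (fun j => (j == i)%:R), 0; split; first exact: normal0.
  rewrite addr0 (bigD1 i) //= eqxx scale1r big1 ?addr0 // => j /negPf->.
  by rewrite scale0r.
Qed.

Lemma derived_normal u : derived br u -> normal u.
Proof.
move=> [s ->]; apply: normal_sumr => p _.
by apply: spanned_br; apply: spannedP.
Qed.

(** * The Magnus embedding *)

Local Notation R := {mpoly k[r]}.
Local Notation W := (R * {ffun 'I_r -> R})%type.

(** The semidirect product of the abelian algebra R with the module R^r. The sign makes bracketing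
    on the right by (f, v) multiply (0, u) by f, as in the action on Fit. *)
Definition magnus_br (x y : W) : W :=
  (0, [ffun i => y.1 * x.2 i - x.1 * y.2 i]).

Let W_ext (x y : W) : x.1 = y.1 -> (forall i, x.2 i = y.2 i) -> x = y.
Proof. by case: x y => [? ?] [? ?] /= -> e; congr pair; apply/ffunP. Qed.

Lemma magnus_lie : lie_alg magnus_br.
Proof.
do !split=> *; apply: W_ext => [|i]; rewrite /= ?scaler0 ?addr0 // !ffunE /= ?ffunE;
  rewrite -?mul_mpolyC; ring.
Qed.

Lemma magnus_metabelian : metabelian magnus_br.
Proof. by move=> *; apply: W_ext => [|i] //; rewrite !ffunE /=; ring. Qed.

Lemma magnus_exists : exists h : L -> W,
  lie_hom br magnus_br h /\ forall l, h (a l) = ('X_l, [ffun i => (l == i)%:R]).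
Proof.
have [_ _ univ] := freeL.
have [h [h_hom ha _]] := univ _ _ magnus_lie magnus_metabelian
  (fun l => ('X_l, [ffun i => (l == i)%:R])).
by exists h.
Qed.

Definition magnus : L -> W :=
  proj1_sig (constructive_indefinite_description _ magnus_exists).

Lemma magnus_hom : lie_hom br magnus_br magnus.
Proof. by case: (proj2_sig (constructive_indefinite_description _ magnus_exists)). Qed.

Lemma magnus_gen l : magnus (a l) = ('X_l, [ffun i => (l == i)%:R]).
Proof. by case: (proj2_sig (constructive_indefinite_description _ magnus_exists)). Qed.

Lemma magnusD x y : magnus (x + y) = magnus x + magnus y.
Proof. by case: magnus_hom. Qed.
Lemma magnusZ c x : magnus (c *: x) = c *: magnus x.
Proof. by case: magnus_hom. Qed.
Lemma magnus_brE x y : magnus (br x y) = magnus_br (magnus x) (magnus y).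
Proof. by case: magnus_hom. Qed.
Lemma magnus0 : magnus 0 = 0.
Proof. by rewrite -[0 in LHS](scale0r (0 : L)) magnusZ scale0r. Qed.

Definition lin x : R := (magnus x).1.
(** The analogue of a Fox derivative with respect to [a i]. *)
Definition coord i x : R := (magnus x).2 i.

Lemma linD x y : lin (x + y) = lin x + lin y.
Proof. by rewrite /lin magnusD. Qed.
Lemma linZ c x : lin (c *: x) = c *: lin x.
Proof. by rewrite /lin magnusZ. Qed.
Lemma lin0 : lin 0 = 0. Proof. by rewrite /lin magnus0. Qed.
Lemma lin_sum I (s : seq I) (F : I -> L) :
  lin (\sum_(i <- s) F i) = \sum_(i <- s) lin (F i).
Proof. exact: (big_morph lin linD lin0). Qed.
Lemma lin_derived u : derived br u -> lin u = 0.
Proof. by move=> [s ->]; rewrite lin_sum big1 // => p _; rewrite /lin magnus_brE. Qed.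

Lemma coordD i x y : coord i (x + y) = coord i x + coord i y.
Proof. by rewrite /coord magnusD ffunE. Qed.
Lemma coordZ i c x : coord i (c *: x) = c *: coord i x.
Proof. by rewrite /coord magnusZ ffunE. Qed.
Lemma coord0 i : coord i 0 = 0.
Proof. by rewrite /coord magnus0 ffunE. Qed.
Lemma coord_sum i I (s : seq I) (F : I -> L) :
  coord i (\sum_(i <- s) F i) = \sum_(j <- s) coord i (F j).
Proof. exact: (big_morph (coord i) (coordD i) (coord0 i)). Qed.
Lemma coord_br i x y : coord i (br x y) = lin y * coord i x - lin x * coord i y.
Proof. by rewrite /coord magnus_brE ffunE. Qed.
Lemma coord_gen i l : coord i (a l) = (l == i)%:R.
Proof. by rewrite /coord magnus_gen ffunE. Qed.
Lemma lin_gen l : lin (a l) = 'X_l.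
Proof. by rewrite /lin magnus_gen. Qed.

(** Since [lin] vanishes on Fit, each bracket with [a j] just multiplies the coordinate by x_j. *)
Lemma coord_ad_mono i m u : derived br u ->
  coord i (ad_mono br a m u) = 'X_[m] * coord i u.
Proof.
move=> du; rewrite mpolyXE_id /ad_mono -big_enum /=.
elim: (enum _) => /= [|j s ih]; first by rewrite big_nil mul1r.
rewrite big_cons -mulrA -{}ih -/(adl m s u).
have dv : derived br (adl m s u) by apply: ad_ind => // *; apply: derived_br.
move: (adl m s u) dv => v dv.
elim: (m j) => [|n ih] /=; first by rewrite expr0 mul1r.
rewrite coord_br lin_gen ih [lin _]lin_derived ?mul0r ?subr0 ?exprS ?mulrA //.
by case: n {ih} => //= n; apply: derived_br.
Qed.

Lemma coord_ract i P u : derived br u -> coord i (ract P u) = P * coord i u.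
Proof.
move=> du; rewrite [in RHS](mpolyE P) coord_sum mulr_suml; apply: eq_bigr => m _.
by rewrite coordZ coord_ad_mono // scalerAl.
Qed.

Lemma coord_br_gen i p q :
  coord i (br (a p) (a q)) = (p == i)%:R * 'X_q - (q == i)%:R * 'X_p.
Proof. by rewrite coord_br !lin_gen !coord_gen mulrC [X in _ - X]mulrC. Qed.

(* [c q] lives in the variables of index [>= q], so the monomials of [c q * 'X_q] have
   least variable exactly [q] and no cancellation between different [q] is possible. *)
Lemma normal_row_eq0 (c : 'I_r -> R) :
  (forall q m, (c q)@_m != 0 -> forall l : 'I_r, (l < q)%N -> m l = 0%N) ->
  \sum_q c q * 'X_q = 0 -> forall q, c q = 0.
Proof.
move=> cn c0 q; apply/mpolyP => m; rewrite mcoeff0; apply/eqP/negPn/negP => cqm.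
have := congr1 (mcoeff (U_(q) + m)%MM) c0.
rewrite mcoeff0 raddf_sum (bigD1 q) //= mcoeffMX big1 ?addr0; first by move/eqP: cqm.
move=> p pq; apply/eqP/negPn/negP; rewrite -mcoeff_msupp (perm_mem (msuppMX _ _)).
case/mapP=> m'; rewrite mcoeff_msupp => /cn m'p dE.
have dEl l : (U_(q) + m)%MM l = (U_(p) + m')%MM l by rewrite dE.
have := dEl p; have := dEl q; rewrite !mnmDE !mnm1E !eqxx (eq_sym q p) !(negPf pq).
case: (ltngtP p q) => [lpq|lqp|/val_inj e]; last by rewrite e eqxx in pq.
  by rewrite (cn _ _ cqm p lpq).
by rewrite (m'p q lqp).
Qed.

(** Coordinate i of the normal sum is the sum of c_iq x_q minus the sum of c_pi x_p. In the second
    sum only p > i can occur, so descending induction on i leaves the row treated by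
    [normal_row_eq0]. *)
Lemma normal_sum_inj c : normal_coef c ->
  (forall i, coord i (normal_sum c) = 0) -> forall i j, c i j = 0.
Proof.
(* Induction on [r - i] treats the largest index first. *)
move=> cn c0 i; have [n] := ubnP (r - i); elim: n i => // n ih i lt_n.
have c_le (p q : 'I_r) : (p <= q)%N -> c p q = 0.
  move=> le; apply/mpolyP=> m; rewrite mcoeff0; apply/eqP/negPn/negP=> /cn[].
  by rewrite ltnNge le.
apply: normal_row_eq0 => [q m /cn[] //|].
have := c0 i; rewrite coord_sum (eq_bigr (fun p : 'I_r =>
    \sum_q (p == i)%:R * (c p q * 'X_q) - \sum_q (q == i)%:R * (c p q * 'X_p))).
  rewrite sumrB (bigD1 i) //= [X in _ + X - _]big1 => [|p /negPf pi]; last first.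
    by rewrite big1 // => q _; rewrite pi mul0r.
  rewrite [X in _ - X]big1 => [|p _]; last first.
    rewrite big1 // => q _; case: eqVneq => [->|]; last by rewrite mul0r.
    have [/c_le->|ip] := leqP p i; first by rewrite mul0r mulr0.
    by rewrite ih ?mul0r ?mulr0 //; have := ltn_ord p; lia.
  rewrite addr0 subr0 => e; rewrite -[RHS]e; apply: eq_bigr => q _.
  by rewrite eqxx mul1r.
move=> p _; rewrite coord_sum -sumrB; apply: eq_bigr => q _.
by rewrite coord_ract ?coord_br_gen; [ring|apply: derived_br].
Qed.

Lemma coord_inj u : derived br u -> (forall i, coord i u = 0) -> u = 0.
Proof.
move=> /derived_normal[c cn ->] /(normal_sum_inj cn) c0.
by rewrite /normal_sum big1 // => i _; rewrite big1 // => j _; rewrite c0 ract0l.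
Qed.

(** * Torsion-freeness of Fit and centralizers *)

(** The coordinates are R-linear and jointly injective on Fit, and R is a domain. *)
Lemma ract_eq0 P u : derived br u -> ract P u = 0 -> P = 0 \/ u = 0.
Proof.
move=> du Pu; have [->|P0] := eqVneq P 0; [by left|right].
apply: coord_inj => // i; have := coord_ract i P du.
by rewrite Pu coord0 => /esym/eqP; rewrite mulf_eq0 (negPf P0) => /eqP.
Qed.

Lemma lin_span (al : 'I_r -> k) w : derived br w ->
  lin (\sum_i al i *: a i + w) = \sum_i al i *: 'X_i.
Proof.
move=> dw; rewrite linD (lin_derived dw) addr0 lin_sum.
by apply: eq_bigr => i _; rewrite linZ lin_gen.
Qed.

Lemma br_lin u x : derived br u -> br u x = ract (lin x) u.
Proof.
move=> du; have [al [w [/normal_derived dw ->]]] := spannedP x.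
by rewrite br_span // lin_span.
Qed.

(** The coefficient of x_i in [lin x] is the coefficient of [a i] in [x] modulo Fit. *)
Lemma lin_eq0 x : lin x = 0 -> derived br x.
Proof.
have [al [w [/normal_derived dw ->]]] := spannedP x; rewrite lin_span // => al0.
rewrite big1 ?add0r // => i _; have := congr1 (mcoeff U_(i)%MM) al0.
rewrite mcoeff0 raddf_sum (bigD1 i) //= mcoeffZ mcoeffXU eqxx mulr1 big1 ?addr0.
  by move->; rewrite scale0r.
by move=> j /negPf ji; rewrite mcoeffZ mcoeffXU ji mulr0.
Qed.

(** This turns membership in Fit into a single equation: Fit is the centralizer of a nonzero element
    of Fit. *)
Lemma derived_annihilator (i j : 'I_r) x : i != j ->
  br (br (a i) (a j)) x = 0 <-> derived br x.
Proof.
move=> ij; split=> [|dx]; last exact/br_derived/dx/derived_br.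
rewrite br_lin; last exact: derived_br.
case/(ract_eq0 (derived_br _ _)) => [/lin_eq0 //|/(congr1 (coord i))/eqP].
(* Coordinate i of [br (a i) (a j)] is x_j, which is nonzero. *)
rewrite coord0 coord_br_gen eqxx (eq_sym j) (negPf ij) mul1r mul0r subr0.
by rewrite -msupp_eq0 msuppX.
Qed.

(** * Homomorphism sets and points as solution sets of equations *)

(** Values on generators extend to a homomorphism exactly when they respect every relation between
    the generators. *)
Lemma hom_setP (M : lmodType R) n (m : 'I_n -> M) (p : 'I_n -> L) : generates m ->
  hom_set br a m p <->
  (forall i, derived br (p i)) /\
  (forall c : 'I_n -> R, \sum_i c i *: m i = 0 -> \sum_i ract (c i) (p i) = 0).
Proof.
move=> gen; split=> [[phi [d phiD phiZ pE]]|[d rel]].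
  split=> [i|c c0]; first by rewrite pE.
  have phi0 : phi 0 = 0 by apply: (@addrI _ (phi 0)); rewrite -phiD !addr0.
  rewrite -[RHS]phi0 -[RHS](congr1 phi c0) (big_morph phi phiD phi0).
  by apply: eq_bigr => i _; rewrite phiZ pE.
pose co x := proj1_sig (constructive_indefinite_description _ (gen x)).
have coE x : x = \sum_i co x i *: m i.
  exact: proj2_sig (constructive_indefinite_description _ (gen x)).
pose phi x := \sum_i ract (co x i) (p i).
(* Two expressions of [x] differ by a relation, so any of them computes [phi]. *)
have phiE x c : x = \sum_i c i *: m i -> phi x = \sum_i ract (c i) (p i).
  move=> xE; apply/eqP; rewrite -subr_eq0; apply/eqP.
  rewrite /phi -sumrB -[RHS](rel (fun i => co x i - c i)).
    by apply: eq_bigr => i _; rewrite ractDl ractNl.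
  rewrite (eq_bigr (fun i => co x i *: m i - c i *: m i)) => [|i _]; last exact: scalerBl.
  by rewrite sumrB -xE -coE subrr.
exists phi; split.
- by move=> x; apply: derived_sum => i; apply: derived_ract.
- move=> x y; rewrite (phiE _ (fun i => co x i + co y i)).
    by rewrite -big_split; apply: eq_bigr => i _; apply: ractDl.
  rewrite {1}(coE x) {1}(coE y) -big_split; apply: eq_bigr => i _ /=.
  by rewrite scalerDl.
- move=> c x; rewrite (phiE _ (fun i => c * co x i)).
    by rewrite ract_sumr; apply: eq_bigr => i _; apply: ractM.
  by rewrite {1}(coE x) scaler_sumr; apply: eq_bigr => i _; rewrite scalerA.
- move=> i; rewrite (phiE _ (fun j => (j == i)%:R)).
    rewrite (bigD1 i) //= eqxx ract1 big1 ?addr0 // => j /negPf->.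
    exact: ract0l.
  by rewrite (bigD1 i) //= eqxx scale1r big1 ?addr0 // => j /negPf->; rewrite scale0r.
Qed.

Definition term_sum n I (s : seq I) (F : I -> term L n) : term L n :=
  foldr (fun i t => tAdd (F i) t) (tConst n 0) s.

Lemma teval_sum n I (s : seq I) (F : I -> term L n) p :
  teval br p (term_sum s F) = \sum_(i <- s) teval br p (F i).
Proof. by elim: s => /= [|i s ->]; rewrite ?big_nil ?big_cons. Qed.

Definition term_ract n (P : R) (t : term L n) : term L n :=
  term_sum (msupp P) (fun m => tScale P@_m
    (foldr (fun i v => iter (m i) (fun w => tBr w (tConst n (a i))) v) t (enum 'I_r))).

Lemma teval_ract n P (t : term L n) p :
  teval br p (term_ract P t) = ract P (teval br p t).
Proof.
rewrite teval_sum; apply: eq_bigr => m _ /=; congr (_ *: _).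
rewrite /ad_mono; elim: (enum _) => //= i s <-.
by elim: (m i) => //= j ->.
Qed.

(** One family of equations puts each variable in Fit, the other imposes each relation between the
    generators. *)
Lemma algebraic_hom_set (M : lmodType R) n (m : 'I_n -> M) (i j : 'I_r) :
  i != j -> generates m -> algebraic br (hom_set br a m).
Proof.
move=> ij gen; exists (fun t =>
  (exists l, t = tBr (tConst n (br (a i) (a j))) (tVar _ l)) \/
  (exists2 c : 'I_n -> R, \sum_l c l *: m l = 0 &
     t = term_sum (index_enum 'I_n) (fun l => term_ract (c l) (tVar _ l)))).
move=> p; rewrite hom_setP //; split=> [[d rel] t|V].
  case=> [[l ->] /=|[c c0 ->]]; first exact/(derived_annihilator _ ij).
  rewrite teval_sum -[RHS](rel c c0); apply: eq_bigr => l _.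
  exact: teval_ract.
split=> [l|c c0].
  apply/(derived_annihilator _ ij).
  exact: V _ (or_introl (ex_intro _ l erefl)).
rewrite -[RHS](V _ (or_intror (ex_intro2 _ _ c c0 erefl))) teval_sum.
by apply: eq_bigr => l _; rewrite teval_ract.
Qed.

Lemma algebraic_point n (q : 'I_n -> L) : algebraic br (fun p => p = q).
Proof.
exists (fun t => exists i, t = tAdd (tVar L i) (tConst n (- q i))) => p.
split=> [-> t [i ->] /=|V]; first by rewrite subrr.
apply: functional_extensionality => i.
have /= := V _ (ex_intro _ i erefl).
by move/eqP; rewrite subr_eq0 => /eqP.
Qed.

(** * Irreducible sets, finite covers and affine terms *)

Lemma zclosed_cut n (Y : ('I_n -> L) -> Prop) N (F : nat -> term L n -> Prop) :
  zclosed br Y -> zclosed br (fun p => Y p /\ exists2 j, (j < N)%N & Vset br (F j) p).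
Proof.
move=> [I [N' [G YE]]].
exists (option I), (fun o => if o is Some i then N' i else N),
  (fun o => if o is Some i then G i else F) => p.
rewrite YE; split=> [[Yp Fp] [i|] //|h].
by split=> [i|]; [exact: h (Some i)|exact: h None].
Qed.

(** Induction on the number of pieces: the last piece contains [Y], or the others cover [Y], or both
    traces on [Y] are proper closed subsets with union [Y]. *)
Lemma irreducible_cover n (Y : ('I_n -> L) -> Prop) N (F : nat -> term L n -> Prop) :
  irreducible br Y ->
  (forall p, Y p -> exists2 j, (j < N)%N & Vset br (F j) p) ->
  exists2 j, (j < N)%N & forall p, Y p -> Vset br (F j) p.
Proof.
move=> [Ycl [p0 Yp0] irr]; elim: N => [|N ih] cover; first by case: (cover p0 Yp0).
have sub (Z : ('I_n -> L) -> Prop) :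
    (forall p, Y p -> Z p) \/ exists p, Y p /\ ~ Z p.
  case: (classic (exists p, Y p /\ ~ Z p)) => [|nex]; [by right|left] => p Yp.
  by apply: NNPP => nZ; apply: nex; exists p.
have [YF|notF] := sub (Vset br (F N)); first by exists N.
have [/ih[j jN Yj]|notC] := sub (fun p => exists2 j, (j < N)%N & Vset br (F j) p).
  by exists j => //; apply: ltnW.
case: irr; exists (fun p => Y p /\ exists2 j, (j < 1)%N & Vset br (F N) p).
exists (fun p => Y p /\ exists2 j, (j < N)%N & Vset br (F j) p).
split; first exact: (zclosed_cut 1 (fun=> F N)).
split; first exact: zclosed_cut.
split; first by move=> p [].
split; first by case: notF => p [Yp nF]; exists p; split=> // -[_ [? _]].
split; first by move=> p [].
split; first by case: notC => p [Yp nF]; exists p; split=> // -[_].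
move=> p; split=> [Yp|[[]|[]] //].
have [j] := cover p Yp; rewrite ltnS leq_eqVlt => /predU1P[->|jN] Fj.
  by left; split=> //; exists 0%N.
by right; split=> //; exists j.
Qed.

(* On [Fit^n] the quadratic part of a term vanishes, because [Fit] is abelian. *)
Lemma teval_affine n (y : 'I_n -> L) (t : term L n) :
  exists P : 'I_n -> R, forall p, (forall i, derived br (p i)) ->
    teval br (fun i => p i + y i) t = teval br y t + \sum_i ract (P i) (p i).
Proof.
elim: t => [c|j|t [P tE] t' [P' tE']|c t [P tE]|t [P tE] t' [P' tE']].
- exists (fun=> 0) => p dp /=.
  by rewrite big1 ?addr0 // => i _; apply: ract0l.
- exists (fun i => (i == j)%:R) => p dp /=; rewrite addrC (bigD1 j) //= eqxx ract1.
  by rewrite big1 ?addr0 // => i /negPf->; apply: ract0l.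
- exists (fun i => P i + P' i) => p dp /=; rewrite tE // tE' // addrACA -big_split.
  by congr (_ + _); apply: eq_bigr => i _; rewrite ractDl.
- exists (fun i => c *: P i) => p dp /=; rewrite tE // scalerDr scaler_sumr.
  by congr (_ + _); apply: eq_bigr => i _; rewrite ractZl.
(* With values y + u and y' + u', where u and u' lie in Fit, the bracket is [y, y'] + [u, y'] -
   [u', y]. *)
exists (fun i => lin (teval br y t') * P i - lin (teval br y t) * P' i) => p dp /=.
rewrite tE // tE' //.
have dU Q : derived br (\sum_i ract (Q i) (p i)).
  by apply: derived_sum => i; apply: derived_ract.
rewrite brDl !brDr (br_derived (dU P) (dU P')) addr0 -addrA; congr (_ + _).
rewrite (br_anti (teval br y t)) !br_lin // !ract_sumr -sumrN -big_split /=.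
by apply: eq_bigr => i _; rewrite addrC ractDl ractNl !ractM.
Qed.

End MetabelianLie.

(** * Structure of irreducible algebraic sets over a finite field *)

(** Modulo Fit each coordinate is a combination of the base, so finitely many algebraic cosets cover
    and one of them contains [Y]. *)
Lemma irreducible_in_coset (k : finFieldType) (r : nat) (L : lmodType k)
  (br : L -> L -> L) (a : 'I_r -> L) (N : nat) (Y : ('I_N -> L) -> Prop) (i0 j0 : 'I_r) :
  free_metabelian_on br a -> i0 != j0 -> irreducible br Y ->
  forall p q, Y p -> Y q -> forall i, derived br (p i - q i).
Proof.
move=> freeL ij irr; have [lieL metL _] := freeL.
pose T := {ffun 'I_N -> {ffun 'I_r -> k}}.
pose b0 : T := [ffun=> [ffun=> 0]].
pose s := enum T.
pose rep (b : T) j := \sum_i b j i *: a i.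
(* The equations say that each x_j minus its representative centralizes [br (a i0) (a j0)], that is,
   lies in Fit. *)
pose F n := fun t : term L N => exists j, t =
  tBr (tConst N (br (a i0) (a j0))) (tAdd (tVar L j) (tConst N (- rep (nth b0 s n) j))).
have FE n p : Vset br (F n) p <-> forall j, derived br (p j - rep (nth b0 s n) j).
  split=> [V j|d t [j ->] /=]; last exact/(derived_annihilator lieL metL freeL _ ij).
  apply/(derived_annihilator lieL metL freeL _ ij).
  exact: V _ (ex_intro _ j erefl).
have [p _|n _ Yn] := @irreducible_cover _ _ br _ Y (size s) F irr.
  pose al j := proj1_sig
    (constructive_indefinite_description _ (spannedP lieL metL freeL (p j))).
  pose b : T := [ffun j => [ffun i => al j i]].
  exists (index b s); first by rewrite index_mem mem_enum.
  apply/FE => j; rewrite nth_index ?mem_enum //.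
  have [w [nw pE]] := proj2_sig
    (constructive_indefinite_description _ (spannedP lieL metL freeL (p j))).
  have -> : rep b j = \sum_i al j i *: a i by apply: eq_bigr => i _; rewrite !ffunE.
  by rewrite pE addrC addKr; apply: normal_derived nw.
move=> p q /Yn/FE dp /Yn/FE dq i.
rewrite -[_ - _](subrKA (rep (nth b0 s n) i)).
by have := derivedN lieL (dq i); rewrite opprB; apply: derivedD.
Qed.

Lemma irreducible_iso_hom_set (k : finFieldType) (r : nat) (L : lmodType k)
  (br : L -> L -> L) (a : 'I_r -> L) (N : nat) (Y : ('I_N -> L) -> Prop) (i0 j0 : 'I_r) :
  free_metabelian_on br a -> i0 != j0 -> algebraic br Y -> irreducible br Y ->
  exists (M : lmodType {mpoly k[r]}) (n : nat) (m : 'I_n -> M),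
    [/\ generates m, torsion_free M & isomorphic br Y (hom_set br a m)].
Proof.
move=> freeL ij [S YE] irr; have [lieL metL _] := freeL.
have coset := irreducible_in_coset freeL ij irr.
have [_ [y Yy] _] := irr.
pose Y0 p := Y (fun i => p i + y i).
have dY0 p : Y0 p -> forall i, derived br (p i).
  by move=> Yp i; have := coset _ _ Yp Yy i; rewrite addrK.
(* A row vector stands for a linear form on Fit^N; [K] below collects the forms that vanish on
   [Y0]. *)
pose ev (c : 'rV[{mpoly k[r]}]_N) p := \sum_i ract br a (c 0 i) (p i).
have evL b c d p : Y0 p -> ev (b *: c + d) p = ract br a b (ev c p) + ev d p.
  move=> /dY0 dp; rewrite (ract_sumr a lieL) -big_split; apply: eq_bigr => i _ /=.
  by rewrite !mxE ractDl ractM.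
pose K c := forall p, Y0 p -> ev c p = 0.
have K0 : K 0 by move=> p _; rewrite /ev big1 // => i _; rewrite mxE ract0l.
have KL b c d : K c -> K d -> K (b *: c + d).
  by move=> Kc Kd p Yp; rewrite evL // Kc // Kd // ract0r // addr0.
have [M [pi [piL pi0 pi_surj]]] := quotient_module_exists K0 KL.
have piD c d : pi (c + d) = pi c + pi d by have := piL 1 c d; rewrite !scale1r.
have pi00 : pi 0 = 0 by apply/pi0.
have piZ b c : pi (b *: c) = b *: pi c by have := piL b c 0; rewrite pi00 !addr0.
pose m i := pi (delta_mx 0 i).
have piE c : pi c = \sum_i c 0 i *: m i.
  rewrite {1}(row_sum_delta c) (big_morph pi piD pi00).
  by apply: eq_bigr => i _; rewrite piZ.
have gen : generates m by move=> x; have [c <-] := pi_surj x; exists (c 0); apply: piE.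
exists M, N, m; split => //.
  (* If b c is in [K], then b kills the value of c at every point of [Y0]; these values lie in the
     torsion-free module Fit. *)
  move=> b x; have [c <-] := pi_surj x; rewrite -piZ => /pi0 Kbc.
  have [->|b0] := eqVneq b 0; [by left|right]; apply/pi0 => p Yp.
  have := Kbc p Yp; rewrite -[_ *: _]addr0 evL // (K0 p Yp) addr0.
  case/(ract_eq0 lieL metL freeL) => // [|bz]; last by rewrite bz eqxx in b0.
  by apply: derived_sum => i; apply: derived_ract => //; apply: dY0.
have homE p : hom_set br a m p <-> Y0 p.
  rewrite (hom_setP a lieL metL p gen); split=> [[dp rel]|Yp].
    apply/YE => t St.
    have [P tE] := teval_affine lieL metL freeL y t.
    have y0 : teval br y t = 0 by apply: (proj1 (YE y) Yy).
    rewrite tE // y0 add0r; apply: rel.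
    (* The constant term of the equation is zero because [y] lies in [Y]; its linear part therefore
       vanishes on [Y0] and is one of the relations of [M]. *)
    have /pi0 : K (\row_i P i).
      move=> q Yq; rewrite -[RHS](proj1 (YE _) Yq t St) (tE _ (dY0 q Yq)) y0 add0r.
      by apply: eq_bigr => i _; rewrite mxE.
    by rewrite piE => P0; rewrite -[RHS]P0; apply: eq_bigr => i _; rewrite mxE.
  split=> [|c c0]; first exact: dY0.
  have /pi0/(_ p Yp) ev0 : pi (\row_i c i) = 0.
    by rewrite piE -[RHS]c0; apply: eq_bigr => i _; rewrite mxE.
  by rewrite -[RHS]ev0 /ev; apply: eq_bigr => i _; rewrite mxE.
(* The isomorphism is translation by -y, with inverse translation by y. *)
exists (fun i => tAdd (tVar L i) (tConst N (- y i))),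
  (fun i => tAdd (tVar L i) (tConst N (y i))); split=> /=.
- move=> p Yp; apply/homE; rewrite /Y0 /=.
  by rewrite (_ : (fun i => _) = p) //; apply: functional_extensionality => i; rewrite subrK.
- by move=> p /homE.
- by move=> p _; apply: functional_extensionality => i; rewrite subrK.
- by move=> p _; apply: functional_extensionality => i; rewrite addrK.
Qed.

Theorem theorem5p1 (k : finFieldType) (r : nat) (L : lmodType k)
  (br : L -> L -> L) (a : 'I_r -> L) :
  (2 <= r)%N -> free_metabelian_on br a ->
  (forall (N : nat) (Y : ('I_N -> L) -> Prop),
     algebraic br Y -> irreducible br Y ->
     (exists (N' : nat) (q : 'I_N' -> L), isomorphic br Y (fun p => p = q))
     \/
     (exists (M : lmodType {mpoly k[r]}) (n : nat) (m : 'I_n -> M),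
        [/\ generates m, torsion_free M &
            isomorphic br Y (hom_set br a m)]))
  /\
  (forall (N : nat) (q : 'I_N -> L), algebraic br (fun p => p = q))
  /\
  (forall (M : lmodType {mpoly k[r]}) (n : nat) (m : 'I_n -> M),
     generates m -> torsion_free M -> algebraic br (hom_set br a m)).
Proof.
move=> r2 freeL; have [lieL metL _] := freeL.
(* These are the indices 0 and 1, which provide a nonzero bracket of base elements. *)
have ij : Ordinal (ltnW r2) != Ordinal r2 by [].
split; first by move=> N Y algY irrY; right; apply: irreducible_iso_hom_set ij algY irrY.
split; first exact: algebraic_point.
by move=> M n m gen _; apply: algebraic_hom_set ij gen.
Qed.
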